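(* Equip $\mathcal T^{\rm ns}(\{\prec,\succ\})$ with the leaf-lexicographic-path order such that $\succ$ is greater than $\prec$. Then the set $\mathrm{DSu}(R_{As})=R_{Dend}$ of relations defining the operad $Dend$ of dendriform algebras, namely the set consisting of $$\begin{aligned}\mathrm{DSu}_1(R_{As})&=\prec(\prec(1,2),3)-\prec(1,\ast(2,3)),\\ \mathrm{DSu}_2(R_{As})&=\prec(\succ(1,2),3)-\succ(1,\prec(2,3)),\\ \mathrm{DSu}_3(R_{As})&=\succ(\ast(1,2),3)-\succ(1,\succ(2,3)),\end{aligned}$$ where $\ast=\prec+\succ$, is a Gröbner-Shirshov basis in the free nonsymmetric operad $\mathbf k\mathcal T^{\rm ns}(\{\prec,\succ\})$.
   Context: $\mathbf k$ is a field. For a set $\mathcal V$ of binary generators, $\mathcal T^{\rm ns}(\mathcal V)$ is the set of planar rooted binary trees (including the trivial tree $|$) whose vertices are decorated by elements of $\mathcal V$ and whose leaves are labelled $1,\dots,n$ from left to right; $\mathbf k\mathcal T^{\rm ns}(\mathcal V)$ is the free nonsymmetric operad on $\mathcal V$. Trees are written functionally: $\alpha(\beta(1,2),3)$ has root $\alpha$ whose left child is $\beta$, and $\alpha(1,\beta(2,3))$ has root $\alpha$ whose right child is $\beta$. $R_{As}=m(m(1,2),3)-m(1,m(2,3))$ is the associativity relation. For a leaf $x$ of a tree $t$ decorated by $m$, $\mathrm{DSu}_x(t)$ (disuccessor) replaces $m$ at each vertex on the path from the root to $x$ by $\prec$ if the path turns left there and by $\succ$ if it turns right, and replaces $m$ at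 every other vertex by $\ast=\prec+\succ$; it is extended linearly. Leaf-lexicographic-path order: a tree with more leaves is larger; for trees with the same number of leaves compare path sequences. The path sequence of $t$ is the sequence, indexed by leaves $1,2,\dots$, of the words of vertex decorations along the path from the root to that leaf. Path sequences are compared word by word (first differing word decides), words being compared degree-lexicographically. $\bar f$ denotes the leading monomial of $f$. Gröbner-Shirshov basis: a $\star$-tree $q$ of arity type $n$ is a decorated tree having exactly one vertex decorated by an extra symbol $\star_n$ with $n$ inputs; $q|_u$ is obtained by replacing this vertex by a tree $u$ with $n$ leaves (extended linearly in $u$). For monic $f,g$: (i) if there are trees $u,v,w$ with $w=\bar f\circ_i u=v\circ_j\bar g$ and $\max\{|V(\bar f)|,|V(\bar g)|\}<|V(w)|<|V(\bar f)|+|V(\bar g)|$ (where $\circ_i$ is grafting at leaf $i$ and $|V(\cdot)|$ is the number of vertices), then $(f,g)_w:=f\circ_i u-v\circ_j g$ is an intersection composition; (ii) if $w=\bar f=q|_{\bar g}$ for a $\star$-tree $q$, then $(f,g)_w:=f-q|_g$ is an including composition. A composition $(f,g)_w$ is trivial modulo $(S,w)$ if $(f,g)_w=\sum_i c_i q_i|_{s_i}$ (finite sum) with $c_i\in\mathbf k\setminus\{0\}$, $s_i\in S$, $q_i$ a $\star$-tree and $q_i|_{\overline{s_i}}<w$. A set $S$ of monic polynomials is a Gröbner-Shirshov basis if, for all $f,g\in S$, all intersection and including compositions $(f,g)_w$ are trivial modulo $(S,w)$. *)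

(* Defs.v *)
From HB Require Import structures.
From mathcomp Require Import all_boot all_order all_algebra.
From mathcomp Require Import finmap.
From mathcomp.multinomials Require Import monalg.

Set Implicit Arguments.
Unset Strict Implicit.
Unset Printing Implicit Defensive.

Import Order.TTheory GRing.Theory.
Local Open Scope ring_scope.

(* The labels 1, ..., n of the leaves are not stored: the leaf labelled x is
   the x-th one from the left. *)
Inductive tree (V : Type) : Type :=
| Leaf
| Node of V & tree V & tree V.
Arguments Leaf {V}.

Section TreeChoice.
Variable V : choiceType.

Fixpoint tree_encode (t : tree V) : GenTree.tree V :=
  match t with
  | Leaf => GenTree.Node 0 [::]
  | Node a l r => GenTree.Node 1 [:: GenTree.Leaf a; tree_encode l; tree_encode r]
  end.

Fixpoint tree_decode (e : GenTree.tree V) : option (tree V) :=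
  match e with
  | GenTree.Node 0 [::] => Some Leaf
  | GenTree.Node 1 [:: GenTree.Leaf a; l; r] =>
      if (tree_decode l, tree_decode r) is (Some l', Some r')
      then Some (Node a l' r') else None
  | _ => None
  end.

Lemma tree_encodeK : pcancel tree_encode tree_decode.
Proof. by elim=> [|a l IHl r IHr] //=; rewrite IHl IHr. Qed.

HB.instance Definition _ := Choice.copy (tree V) (pcan_type tree_encodeK).

End TreeChoice.

Section Trees.
Variable V : Type.
Implicit Types t u : tree V.

Fixpoint leaves t : nat :=
  if t is Node _ l r then leaves l + leaves r else 1%N.

Fixpoint vertices t : nat :=
  if t is Node _ l r then (vertices l + vertices r).+1 else 0%N.

(* Words are read from the root to the leaf. *)
Fixpoint paths t : seq (seq V) :=
  if t is Node a l r then [seq a :: w | w <- paths l ++ paths r]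
  else [:: [::]].

(* t \circ_i u, meaningful for 1 <= i <= leaves t. *)
Fixpoint graft t (i : nat) u : tree V :=
  match t with
  | Leaf => u
  | Node a l r =>
      if (i <= leaves l)%N then Node a (graft l i u) r
      else Node a l (graft r (i - leaves l) u)
  end.

(* Grafts the i-th tree of ts at the i-th leaf of t, for all i at once;
   meaningful for size ts = leaves t. *)
Fixpoint graft_all t (ts : seq (tree V)) : tree V :=
  match t with
  | Leaf => head Leaf ts
  | Node a l r => Node a (graft_all l (take (leaves l) ts))
                         (graft_all r (drop (leaves l) ts))
  end.

(* A decorated tree with exactly one vertex decorated by star_n, presented by
   the path from its root down to that vertex. *)
Inductive star_tree (n : nat) : Type :=
| Star of n.-tuple (tree V)
| StarL of V & star_tree n & tree V
| StarR of V & tree V & star_tree n.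

(* q|_u *)
Fixpoint plug n (q : star_tree n) u : tree V :=
  match q with
  | Star ts => graft_all u ts
  | StarL a q' r => Node a (plug q' u) r
  | StarR a l q' => Node a l (plug q' u)
  end.

Lemma size_paths t : size (paths t) = leaves t.
Proof. by elim: t => //= a l IHl r IHr; rewrite size_map size_cat IHl IHr. Qed.

Lemma cat_paths_inj t u p s s' :
  [seq p ++ w | w <- paths t] ++ s = [seq p ++ w | w <- paths u] ++ s' ->
  t = u /\ s = s'.
Proof.
have hd v : exists w ws, paths v = w :: ws.
  elim: v => [|a l [w [ws /= ->]] r _] /=; first by exists [::], [::].
  by exists (a :: w), [seq a :: w | w <- ws ++ paths r].
have push q (a : V) v :
    [seq q ++ w | w <- [seq a :: w | w <- v]] = [seq rcons q a ++ w | w <- v].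
  by rewrite -map_comp; apply: eq_map => w /=; rewrite cat_rcons.
elim: t u p s s' => [|a l IHl r IHr] [|b l' r'] p s s' /=; rewrite ?push.
- by case.
- have [w [ws ->]] := hd l' => -[/(congr1 size)].
  by rewrite cats0 size_cat size_rcons => /eqP; rewrite addSn ltn_eqF // ltnS leq_addr.
- have [w [ws ->]] := hd l => -[/(congr1 size)].
  by rewrite cats0 size_cat size_rcons => /eqP; rewrite addSn gtn_eqF // ltnS leq_addr.
move=> E; have ab : a = b.
  move: E; have [w [ws ->]] := hd l; have [w' [ws' ->]] := hd l'; case=> + _.
  by rewrite !cat_rcons => /(congr1 (drop (size p))); rewrite !drop_size_cat // => -[].
move: E; rewrite ab !map_cat -!catA => E.
by have [-> E'] := IHl _ _ _ _ E; have [-> ->] := IHr _ _ _ _ E'.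
Qed.

Lemma paths_inj : injective paths.
Proof.
move=> t u E; have [] // := @cat_paths_inj t u [::] [::] [::].
by rewrite E.
Qed.

End Trees.

(* Leaf-lexicographic-path order. *)
Section TreeOrder.
Context {d : Order.disp_t} {V : orderType d}.
Implicit Types t u : tree V.

(* Degree-lexicographic order on words. *)
Definition word_key (w : seq V) : nat *l seqlexi V := (size w, w).

Definition path_key t : nat *l seqlexi (nat *l seqlexi V) :=
  (leaves t, [seq word_key w | w <- paths t]).

Lemma path_key_inj : injective path_key.
Proof.
move=> t u [_ /inj_map E]; apply/paths_inj/E.
by move=> w w' [].
Qed.

Definition tree_le t u : bool := (path_key t <= path_key u)%O.

Lemma tree_le_refl : reflexive tree_le.
Proof. by move=> t; apply: lexx. Qed.

Lemma tree_le_anti : antisymmetric tree_le.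
Proof. by move=> t u /le_anti /path_key_inj. Qed.

Lemma tree_le_trans : transitive tree_le.
Proof. by move=> u t v; apply: le_trans. Qed.

Lemma tree_le_total : total tree_le.
Proof. by move=> t u; apply: le_total. Qed.

HB.instance Definition _ :=
  Order.Le_isPOrder.Build d (tree V) tree_le_refl tree_le_anti tree_le_trans.
HB.instance Definition _ :=
  Order.POrder_isTotal.Build d (tree V) tree_le_total.

Lemma leaf_le t : (Leaf <= t)%O.
Proof.
case: t => [|a l r]; first exact: lexx.
rewrite /Order.le /= /tree_le /path_key /=.
apply/ltW; rewrite ltxi_pair.
have leaves_gt0 (v : tree V) : (0 < leaves v)%N.
  by elim: v => //= *; rewrite addn_gt0; apply/orP; left.
move: (leaves_gt0 l) (leaves_gt0 r); case: (leaves l) => // n; case: (leaves r) => // m _ _.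
by rewrite addnS; apply/andP; split.
Qed.

End TreeOrder.

(* k T^ns(V) is {malg K[tree V]}; its elements of arity n are the ones
   supported on trees with n leaves. *)
Definition homogeneous (K : fieldType) (V : choiceType) (n : nat)
    (f : {malg K[tree V]}) : Prop :=
  forall t, t \in msupp f -> leaves t = n.

Definition linext (K : fieldType) (V : choiceType) (F : tree V -> tree V)
    (f : {malg K[tree V]}) : {malg K[tree V]} :=
  \sum_(t <- msupp f) f@_t *: << F t >>.

(* The operation a, extended bilinearly. *)
Definition node2 (K : fieldType) (V : choiceType) (a : V)
    (f g : {malg K[tree V]}) : {malg K[tree V]} :=
  \sum_(t <- msupp f) \sum_(u <- msupp g) (f@_t * g@_u) *: << Node a t u >>.

Section GroebnerShirshov.
Context {K : fieldType} {d : Order.disp_t} {V : orderType d}.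
Implicit Types (f g h : {malg K[tree V]}) (S : {malg K[tree V]} -> Prop).

(* Leaf is the least tree, so this is the greatest tree of the support of a
   nonzero f; lead 0 = Leaf is junk. *)
Definition lead f : tree V := \big[Order.max/Leaf]_(t <- msupp f) t.

Definition monic f : Prop := f@_(lead f) = 1.

Definition arity f : nat := leaves (lead f).

(* f \circ_i u *)
Definition lgraft f (i : nat) (u : tree V) : {malg K[tree V]} :=
  linext (fun t => graft t i u) f.

(* v \circ_j g *)
Definition rgraft (v : tree V) (j : nat) g : {malg K[tree V]} :=
  linext (graft v j) g.

(* q|_g, for g homogeneous of arity n *)
Definition lplug n (q : star_tree V n) g : {malg K[tree V]} :=
  linext (plug q) g.

(* composition f g w h: h is a composition (f, g)_w. *)
Inductive composition f g : tree V -> {malg K[tree V]} -> Prop :=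
| Intersection (u v w : tree V) (i j : nat) of
    (1 <= i <= leaves (lead f))%N & (1 <= j <= leaves v)%N &
    w = graft (lead f) i u & w = graft v j (lead g) &
    (maxn (vertices (lead f)) (vertices (lead g)) < vertices w)%N &
    (vertices w < vertices (lead f) + vertices (lead g))%N :
    composition f g w (lgraft f i u - rgraft v j g)
| Including (w : tree V) (q : star_tree V (arity g)) of
    w = lead f & w = plug q (lead g) :
    composition f g w (f - lplug q g).

Definition trivial_mod S (w : tree V) h : Prop :=
  exists (N : nat) (c : 'I_N -> K) (s : 'I_N -> {malg K[tree V]})
         (q : forall i, star_tree V (arity (s i))),
    [/\ forall i, c i != 0,
        forall i, S (s i),
        forall i, (plug (q i) (lead (s i)) < w)%O
      & h = \sum_(i < N) c i *: lplug (q i) (s i)].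

Definition groebner_shirshov S : Prop :=
  (forall f, S f -> homogeneous (arity f) f /\ monic f) /\
  (forall f g w h, S f -> S g -> composition f g w h -> trivial_mod S w h).

End GroebnerShirshov.

Inductive dend_gen : Type := Prec | Succ.

Definition is_succ (a : dend_gen) : bool := if a is Succ then true else false.
Definition gen_of_bool (b : bool) : dend_gen := if b then Succ else Prec.

Lemma is_succK : cancel is_succ gen_of_bool.
Proof. by case. Qed.

HB.instance Definition _ := Choice.copy dend_gen (can_type is_succK).
Definition dend_gen_le (a b : dend_gen) : bool := is_succ a ==> is_succ b.

Lemma dend_gen_le_refl : reflexive dend_gen_le.
Proof. by case. Qed.

Lemma dend_gen_le_anti : antisymmetric dend_gen_le.
Proof. by move=> [] []. Qed.

Lemma dend_gen_le_trans : transitive dend_gen_le.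
Proof. by move=> [] [] []. Qed.

Lemma dend_gen_le_total : total dend_gen_le.
Proof. by move=> [] []. Qed.

HB.instance Definition _ := Order.Le_isPOrder.Build (Order.Disp tt tt) dend_gen
  dend_gen_le_refl dend_gen_le_anti dend_gen_le_trans.
HB.instance Definition _ := Order.POrder_isTotal.Build (Order.Disp tt tt) dend_gen
  dend_gen_le_total.

Lemma Prec_lt_Succ : (Prec < Succ)%O.
Proof. by []. Qed.

Section Disuccessor.
Variable K : fieldType.
Local Notation dend := {malg K[tree dend_gen]}.

Definition prec (f g : dend) : dend := node2 Prec f g.
Definition succ (f g : dend) : dend := node2 Succ f g.
Definition ast (f g : dend) : dend := prec f g + succ f g.

(* The trivial tree. *)
Definition triv : dend := << Leaf >>.

(* Trees decorated by the single operation m are elements of tree unit. *)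
Fixpoint all_ast (t : tree unit) : dend :=
  match t with
  | Leaf => triv
  | Node _ l r => ast (all_ast l) (all_ast r)
  end.

Fixpoint dsu_tree (x : nat) (t : tree unit) : dend :=
  match t with
  | Leaf => triv
  | Node _ l r =>
      if (x <= leaves l)%N then prec (dsu_tree x l) (all_ast r)
      else succ (all_ast l) (dsu_tree (x - leaves l) r)
  end.

Definition DSu (x : nat) (f : {malg K[tree unit]}) : dend :=
  \sum_(t <- msupp f) f@_t *: dsu_tree x t.

(* DSu (f), for f homogeneous of arity n. *)
Definition DSu_set (n : nat) (f : {malg K[tree unit]}) (h : dend) : Prop :=
  exists2 x, (1 <= x <= n)%N & h = DSu x f.

Definition R_As : {malg K[tree unit]} :=
  << Node tt (Node tt Leaf Leaf) Leaf >> -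
  << Node tt Leaf (Node tt Leaf Leaf) >>.

End Disuccessor.

(* Main.v *)
(** The leading trees of the three relations are the left combs with
    decorations (≺,≺), (≺,≻) and (≻,≻), read from the root.  A left comb with
    two vertices meets another one properly only in a left comb with three
    vertices, so the only ambiguities are ≺≺≺, ≺≺≻, ≺≻≻ and ≻≻≻; each resolves
    by rewriting both sides to normal form.  The leading trees are distinct
    and have equally many vertices, so including compositions vanish. *)
From HB Require Import structures.
Require Import Defs.
From mathcomp Require Import all_boot all_order all_algebra.
From mathcomp Require Import finmap.
From mathcomp.multinomials Require Import monalg.
Local Open Scope ring_scope.
Set Implicit Arguments.
Unset Strict Implicit.
Import Order.TTheory GRing.Theory.

(** * Linear extension of maps defined on a basis *)

Section LinearExtension.
Variables (K : fieldType) (T : choiceType) (M : lmodType K) (h : T -> M).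
Implicit Types f g : {malg K[T]}.

(** The common shape of [linext], [DSu] and, when nested, [node2], so that linearity is proved only
    once. *)
Definition malg_extend f : M := \sum_(t <- msupp f) f@_t *: h t.

Lemma malg_extendEw (d : {fset T}) f : (msupp f `<=` d)%fset ->
  malg_extend f = \sum_(t <- d) f@_t *: h t.
Proof.
move=> sfd; apply: big_fset_incl => // t _ /mcoeff_outdom ->.
by rewrite scale0r.
Qed.

Lemma malg_extend_is_linear : linear malg_extend.
Proof.
(* The three supports may differ, so all sums are taken over one finite set containing them; the
   added terms have coefficient zero. *)
move=> c f g; pose d := (msupp (c *: f + g) `|` (msupp f `|` msupp g))%fset.
rewrite !(@malg_extendEw d) ?fsubsetUl //.
- rewrite scaler_sumr -big_split; apply: eq_bigr => t _ /=.
  by rewrite mcoeffD mcoeffZ scalerDl scalerA.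
- by rewrite /d fsetUA fsubsetUr.
- by rewrite /d fsetUCA fsubsetUl.
Qed.

HB.instance Definition _ :=
  GRing.isLinear.Build K {malg K[T]} M _ malg_extend malg_extend_is_linear.

Lemma malg_extendU t : malg_extend << t >> = h t.
Proof. by rewrite /malg_extend msuppU oner_eq0 big_seq_fset1 mcoeffUU scale1r. Qed.

End LinearExtension.

Lemma linextE (K : fieldType) (V : choiceType) (F : tree V -> tree V) :
  linext F =1 malg_extend (fun t => << F t >> : {malg K[tree V]}).
Proof. by []. Qed.

Lemma node2E (K : fieldType) (V : choiceType) (a : V) (f g : {malg K[tree V]}) :
  node2 a f g =
  malg_extend (fun t => malg_extend (fun u => << Node a t u >>) g) f.
Proof.
apply: eq_bigr => t _; rewrite scaler_sumr.
by apply: eq_bigr => u _; rewrite scalerA.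
Qed.

Lemma eq_linext (K : fieldType) (V : choiceType) (F : tree V -> tree V)
    (f : {malg K[tree V]}) :
  (forall t, t \in msupp f -> F t = t) -> linext F f = f.
Proof.
move=> Fid; rewrite [RHS]monalgE /linext big_seq [RHS]big_seq.
apply: eq_bigr => t /Fid ->.
by apply/malgP => u; rewrite mcoeffZ !mcoeffU mulr_natr.
Qed.

(** * Vertex counts under grafting and plugging *)

Section TreeLemmas.
Variable V : Type.
Implicit Types t u : tree V.

Lemma vertices_graft t i u : (1 <= i <= leaves t)%N ->
  vertices (graft t i u) = (vertices t + vertices u)%N.
Proof.
elim: t i => [|a l IHl r IHr] i //= /andP[i_gt0 le_i].
case: leqP => [le_il|lt_li] /=.
  by rewrite IHl ?i_gt0 // addSn addnAC.
by rewrite IHr ?addSn ?addnA // subn_gt0 lt_li leq_subLR.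
Qed.

Lemma vertices_graft_all t ts : size ts = leaves t ->
  vertices (graft_all t ts) = (vertices t + sumn [seq vertices u | u <- ts])%N.
Proof.
elim: t ts => [|a l IHl r IHr] /= ts sz_ts.
  by case: ts sz_ts => [|u []] //= _; rewrite addn0.
rewrite IHl ?IHr ?size_drop ?sz_ts ?addKn // ?size_takel ?sz_ts ?leq_addr //.
rewrite addnACA -sumn_cat -map_cat cat_take_drop.
by rewrite addSn.
Qed.

Lemma graft_all_nseq t : graft_all t (nseq (leaves t) Leaf) = t.
Proof.
elim: t => //= a l IHl r IHr.
by rewrite take_nseq ?leq_addr // drop_nseq addKn IHl IHr.
Qed.

Lemma vertices_plug_ge n (q : star_tree V n) t : leaves t = n ->
  (vertices t <= vertices (plug q t))%N.
Proof.
move=> eq_n; elim: q => [ts|a q IH r|a l q IH] /=.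
- by rewrite vertices_graft_all ?size_tuple // leq_addr.
- exact: leq_trans IH (leqW (leq_addr _ _)).
- exact: leq_trans IH (leqW (leq_addl _ _)).
Qed.

(** Plugging adds vertices unless the star is the root and all trees grafted onto it are trivial;
    such a star-tree acts as the identity on every tree with [n] leaves. *)
Lemma plug_same_vertices n (q : star_tree V n) t : leaves t = n ->
  vertices (plug q t) = vertices t ->
  forall u, leaves u = n -> plug q u = u.
Proof.
move=> eq_n; case: q => [ts|a q r|a l q] /=; last first.
- by move=> E; have := vertices_plug_ge q eq_n; rewrite -E ltnNge leq_addl.
- by move=> E; have := vertices_plug_ge q eq_n; rewrite -E ltnNge leq_addr.
rewrite vertices_graft_all ?size_tuple // => /eqP.
rewrite -[X in _ == X]addn0 eqn_add2l => /eqP sum0 u eq_nu.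
suff -> : tval ts = nseq (leaves u) Leaf by apply: graft_all_nseq.
rewrite eq_nu -{2}(size_tuple ts).
by elim: {ts}(tval ts) sum0 => //= -[|a l r] ts IH // /IH {1}->.
Qed.

End TreeLemmas.

(** * Leading trees and closure properties of triviality *)

Section Leading.
Context {K : fieldType} {d : Order.disp_t} {V : orderType d}.
Implicit Types (f g h s : {malg K[tree V]}) (S : {malg K[tree V]} -> Prop).

Lemma lead_eq f t : t \in msupp f -> (forall u, u \in msupp f -> u <= t)%O ->
  lead f = t.
Proof.
move=> tf le_t; apply/eqP; rewrite eq_le; apply/andP; split.
  (* The maximum starts from [Leaf], which lies below every tree. *)
  rewrite /lead big_seq; elim/big_ind: _ => //; first exact: leaf_le.
  by move=> u v; rewrite ge_max => -> ->.
rewrite /lead.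
have : t \in (msupp f : seq _) by [].
elim: (msupp f : seq _) => //= u r IH; rewrite inE big_cons le_max.
by case/orP=> [/eqP ->|/IH ->]; rewrite ?lexx ?orbT.
Qed.

Lemma trivial_mod0 S w : trivial_mod S w 0.
Proof.
exists 0, (fun=> 0), (fun=> 0), (fun=> Star (nseq_tuple _ Leaf)).
by split; try (by case); rewrite big_ord0.
Qed.

Lemma trivial_modD S w g h :
  trivial_mod S w g -> trivial_mod S w h -> trivial_mod S w (g + h).
Proof.
move=> [N [c [s [q [c0 Ss lt_w ->]]]]] [M [c' [s' [q' [c0' Ss' lt_w' ->]]]]].
(* The type of each star-tree depends on the arity of its polynomial, so the two families are joined
   over the sum type and only then reindexed through [split]. *)
pose ss (o : 'I_N + 'I_M) := match o with inl i => s i | inr j => s' j end.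
pose cc (o : 'I_N + 'I_M) := match o with inl i => c i | inr j => c' j end.
pose qq (o : 'I_N + 'I_M) : star_tree V (arity (ss o)) :=
  match o with inl i => q i | inr j => q' j end.
exists (N + M)%N, (fun i => cc (split i)), (fun i => ss (split i)),
  (fun i => qq (split i)).
split; try by move=> i; case: (split i).
pose F o := cc o *: lplug (qq o) (ss o).
have FE (o : 'I_N + 'I_M) : F (split (unsplit o)) = F o by rewrite unsplitK.
rewrite [RHS](big_split_ord _ _ (fun i => F (split i))).
by apply: f_equal2; apply: eq_bigr => i _; [rewrite (FE (inl i))|rewrite (FE (inr i))].
Qed.

Lemma trivial_modN S w h : trivial_mod S w h -> trivial_mod S w (- h).
Proof.
move=> [N [c [s [q [c0 Ss lt_w ->]]]]]; exists N, (fun i => - c i), s, q.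
split=> // [i|]; first by rewrite oppr_eq0.
by rewrite -sumrN; apply: eq_bigr => i _; rewrite scaleNr.
Qed.

(** Keeping [n] apart from [arity s] allows star-trees written with a literal number of inputs. *)
Lemma trivial_mod_lplug S w n (q : star_tree V n) s :
  S s -> arity s = n -> (plug q (lead s) < w)%O ->
  trivial_mod S w (lplug q s).
Proof.
move=> Ss ar_s; case: n / ar_s q => q lt_w.
exists 1, (fun=> 1), (fun=> s), (fun=> q).
by split=> //; rewrite ?big_ord1 ?scale1r // => _; apply: oner_neq0.
Qed.

Lemma lplug_same_vertices g (q : star_tree V (arity g)) :
  homogeneous (arity g) g -> vertices (plug q (lead g)) = vertices (lead g) ->
  lplug q g = g.
Proof.
move=> hom_g same_v; apply: eq_linext => t /hom_g.
exact: plug_same_vertices same_v _.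
Qed.

End Leading.

(** * Overlaps of left combs *)

Local Notation corolla a := (Node a Leaf Leaf).
Local Notation left_comb a b := (Node a (Node b Leaf Leaf) Leaf).
Local Notation right_comb a b := (Node a Leaf (Node b Leaf Leaf)).

Lemma vertices_eq1 (V : Type) (t : tree V) :
  vertices t = 1 -> exists a, t = corolla a.
Proof.
case: t => [//|a [|b l r] [|c l' r']] //= _; by exists a.
Qed.

(** Both combs have two vertices, so the bounds leave exactly one vertex for [u] and one for [v]. Of
    the finitely many positions only [i = j = 1] fit: elsewhere one grafted tree has a leaf where
    the other has a vertex. *)
Lemma left_comb_overlap (V : Type) (a b a' b' : V) i j (u v w : tree V) :
    (1 <= i <= 3)%N -> (1 <= j <= leaves v)%N ->
    w = graft (left_comb a b) i u -> w = graft v j (left_comb a' b') ->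
    (2 < vertices w)%N -> (vertices w < 4)%N ->
  [/\ i = 1, j = 1, u = corolla b', v = corolla a & b = a'].
Proof.
move=> i3 jv wu wv w_gt2 w_lt4.
have u1 : vertices u = 1.
  apply/eqP; rewrite eqn_leq -(ltn_add2l 2) -(leq_add2l 2) andbC.
  by rewrite -(vertices_graft (t := left_comb a b) u i3) -wu w_gt2.
have v1 : vertices v = 1.
  apply/eqP; rewrite eqn_leq -(ltn_add2r 2) -(leq_add2r 2) andbC.
  by rewrite -(vertices_graft (left_comb a' b') jv) -wv w_gt2.
have [e ue] := vertices_eq1 u1; have [e' ve] := vertices_eq1 v1.
move: wu wv jv; rewrite {}ue {}ve {u v u1 v1} => -> + /=.
case: i i3 => [|[|[|[|i]]]] // _; case: j => [|[|[|j]]] //=;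
  try by case.
by case=> -> -> ->.
Qed.

(** * Polynomials as lists of terms, compared by computation *)

Section Terms.
Variables (K : fieldType) (T : choiceType).
Implicit Types (f g : {malg K[T]}) (r : seq (int * T)).

(* Integer coefficients make equalities between such sums decidable by
   computation, whatever the field. *)
Definition terms r : {malg K[T]} := \sum_(p <- r) p.1%:~R *: << p.2 >>.

Fixpoint coef r (t : T) : int :=
  if r is p :: r' then (if p.2 == t then p.1 else 0) + coef r' t else 0.

Definition same_terms r1 r2 : bool :=
  all (fun p => coef r1 p.2 == coef r2 p.2) (r1 ++ r2).

Lemma mcoeff_terms r t : (terms r)@_t = (coef r t)%:~R.
Proof.
rewrite /terms; elim: r => [|p r IH]; first by rewrite big_nil mcoeff0.
rewrite big_cons mcoeffD mcoeffZ mcoeffU IH /= intrD mulr_natr.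
by case: eqP.
Qed.

Lemma coef_notin r t : t \notin [seq p.2 | p <- r] -> coef r t = 0.
Proof.
elim: r => //= p r IH; rewrite inE negb_or eq_sym => /andP[/negPf -> /IH ->].
by [].
Qed.

Lemma msupp_terms r t : t \in msupp (terms r) -> t \in [seq p.2 | p <- r].
Proof.
rewrite -mcoeff_neq0 mcoeff_terms; apply: contra_neqT => /coef_notin ->.
by [].
Qed.

(** A tree in neither list has coefficient zero on both sides, so testing the listed trees suffices;
    an equality of integers carries over to any field. *)
Lemma eq_terms f g r1 r2 :
  f = terms r1 -> g = terms r2 -> same_terms r1 r2 -> f = g.
Proof.
move=> -> -> /allP same; apply/malgP => t; rewrite !mcoeff_terms.
have [/mapP[p rp ->]|] := boolP (t \in [seq p.2 | p <- r1 ++ r2]).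
  by rewrite (eqP (same p rp)).
by rewrite map_cat mem_cat negb_or => /andP[/coef_notin -> /coef_notin ->].
Qed.

Lemma termsU t : << t >> = terms [:: (1, t)].
Proof. by rewrite /terms big_seq1 scale1r. Qed.

Lemma termsD f g r1 r2 :
  f = terms r1 -> g = terms r2 -> f + g = terms (r1 ++ r2).
Proof. by move=> -> ->; rewrite /terms big_cat. Qed.

Lemma termsN f r : f = terms r -> - f = terms [seq (- p.1, p.2) | p <- r].
Proof.
move=> ->; rewrite /terms -sumrN big_map; apply: eq_bigr => p _ /=.
by rewrite intrN scaleNr.
Qed.

Lemma malg_extend_terms (M : lmodType K) (h : T -> M) r :
  malg_extend h (terms r) = \sum_(p <- r) p.1%:~R *: h p.2.
Proof.
by rewrite linear_sum; apply: eq_bigr => p _; rewrite linearZ /= malg_extendU.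
Qed.

End Terms.

Lemma terms_linext (K : fieldType) (V : choiceType) (F : tree V -> tree V)
    (f : {malg K[tree V]}) r :
  f = terms K r -> linext F f = terms K [seq (p.1, F p.2) | p <- r].
Proof. by move=> ->; rewrite linextE malg_extend_terms /terms big_map. Qed.

Lemma terms_node2 (K : fieldType) (V : choiceType) (a : V)
    (f g : {malg K[tree V]}) r1 r2 :
  f = terms K r1 -> g = terms K r2 ->
  node2 a f g =
  terms K [seq (p.1 * q.1, Node a p.2 q.2) | p <- r1, q <- r2].
Proof.
move=> -> ->; rewrite node2E malg_extend_terms /terms big_allpairs_dep.
apply: eq_bigr => p _; rewrite malg_extend_terms scaler_sumr.
by apply: eq_bigr => q _; rewrite scalerA intrM.
Qed.

(** Trees of the tail are strictly smaller than [t], hence different from it, so the coefficient of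
    [t] is exactly 1; cancellation within the tail cannot affect the maximum. *)
Lemma lead_terms (K : fieldType) (d : Order.disp_t) (V : orderType d)
    (t : tree V) r :
  all (fun p => p.2 < t)%O r ->
  lead (terms K ((1, t) :: r)) = t /\ Defs.monic (terms K ((1, t) :: r)).
Proof.
move=> /allP lt_t.
have ct : (terms K ((1, t) :: r))@_t = 1.
  rewrite mcoeff_terms /= eqxx coef_notin ?addr0 //.
  by apply/negP => /mapP[p /lt_t + tE]; rewrite -tE ltxx.
suff leadE : lead (terms K ((1, t) :: r)) = t by split; rewrite // /Defs.monic leadE.
apply: lead_eq => [|u /msupp_terms]; first by rewrite -mcoeff_neq0 ct oner_neq0.
rewrite inE => /orP[/eqP -> //|/mapP[p /lt_t + ->]]; exact: ltW.
Qed.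

Lemma homogeneous_terms (K : fieldType) (V : choiceType) n r :
  all (fun p => leaves p.2 == n) r ->
  homogeneous n (terms K r : {malg K[tree V]}).
Proof. by move=> /allP ar_n t /msupp_terms /mapP[p /ar_n/eqP ? ->]. Qed.

(** The list is an existential variable, solved along the shape of the expression; the last case
    unfolds [dend1], [dend2] or [dend3], which are [terms] by definition. *)
Local Ltac as_terms :=
  lazymatch goal with
  | |- _ + _ = _ => eapply termsD; as_terms
  | |- - _ = _ => eapply termsN; as_terms
  | |- lplug _ _ = _ => eapply terms_linext; as_terms
  | |- lgraft _ _ _ = _ => eapply terms_linext; as_terms
  | |- rgraft _ _ _ = _ => eapply terms_linext; as_terms
  | |- node2 _ _ _ = _ => eapply terms_node2; as_terms
  | |- << _ >> = _ => eapply termsU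
  | |- _ => reflexivity
  end.

Local Ltac by_terms := eapply eq_terms; [as_terms | as_terms | by vm_compute].

(** * The dendriform relations and their four ambiguities *)

Section Dendriform.
Variable K : fieldType.
Local Notation S := (DSu_set 3 (R_As K)).

Definition dend1 : {malg K[tree dend_gen]} :=
  terms K [:: (1, left_comb Prec Prec);
            (-1, right_comb Prec Prec); (-1, right_comb Prec Succ)].
Definition dend2 : {malg K[tree dend_gen]} :=
  terms K [:: (1, left_comb Prec Succ); (-1, right_comb Succ Prec)].
Definition dend3 : {malg K[tree dend_gen]} :=
  terms K [:: (1, left_comb Succ Succ);
            (1, left_comb Succ Prec); (-1, right_comb Succ Succ)].

Lemma DSu_R_As x : DSu x (R_As K) =
  dsu_tree K x (left_comb tt tt) - dsu_tree K x (right_comb tt tt).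
Proof.
rewrite -[LHS]/(malg_extend (dsu_tree K x) (R_As K)) linearB /=.
by apply: f_equal2; rewrite malg_extendU.
Qed.

Lemma DSu_terms :
  [/\ DSu 1 (R_As K) = dend1, DSu 2 (R_As K) = dend2 & DSu 3 (R_As K) = dend3].
Proof.
by rewrite !DSu_R_As /= /ast /prec /succ /triv; split; by_terms.
Qed.

Lemma DSu_setP f : S f -> [\/ f = dend1, f = dend2 | f = dend3].
Proof.
have [E1 E2 E3] := DSu_terms.
case=> -[|[|[|[|x]]]] // _ ->; rewrite ?E1 ?E2 ?E3.
- exact: Or31.
- exact: Or32.
- exact: Or33.
Qed.

Lemma dend_in_DSu_set : [/\ S dend1, S dend2 & S dend3].
Proof. by have [<- <- <-] := DSu_terms; split; [exists 1|exists 2|exists 3]. Qed.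

(** A left comb exceeds the right combs already at the first leaf, whose word has length two instead
    of one. *)
Lemma lead_dend1 : lead dend1 = left_comb Prec Prec.
Proof. by apply lead_terms. Qed.

Lemma lead_dend2 : lead dend2 = left_comb Prec Succ.
Proof. by apply lead_terms. Qed.

(** Two left combs occur, with first words of equal length, so here the choice of ≻ above ≺
    decides. *)
Lemma lead_dend3 : lead dend3 = left_comb Succ Succ.
Proof. by apply lead_terms. Qed.

Local Notation root3 t u v := (@Star dend_gen 3 [tuple of [:: t; u; v]]).
Local Notation lll := (root3 Leaf Leaf Leaf).

Local Ltac trivial_sum :=
  lazymatch goal with
  | |- trivial_mod _ _ (_ + _) => apply: trivial_modD; trivial_sum
  | |- trivial_mod _ _ (- _) => apply: trivial_modN; trivial_sum
  | |- trivial_mod _ _ (lplug _ _) =>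
      apply: trivial_mod_lplug; [by case: dend_in_DSu_set | |];
      rewrite /arity ?lead_dend1 ?lead_dend2 ?lead_dend3; by vm_compute
  end.

(** Write x1, ..., x4 for the leaves. The first four summands reduce the terms of the composition;
    what remains is x1 ≺ [(x2 ∗ x3) ∗ x4 - x2 ∗ (x3 ∗ x4)], and the bracket is the sum of the three
    relations. *)
Lemma ambiguity_Prec_Prec_Prec :
  trivial_mod S (graft (left_comb Prec Prec) 1 (corolla Prec))
    (lgraft dend1 1 (corolla Prec) - rgraft (corolla Prec) 1 dend1).
Proof.
have -> : lgraft dend1 1 (corolla Prec) - rgraft (corolla Prec) 1 dend1 =
    lplug (root3 Leaf (corolla Prec) Leaf) dend1
    + lplug (root3 Leaf (corolla Succ) Leaf) dend1
    - lplug (root3 Leaf Leaf (corolla Prec)) dend1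
    - lplug (root3 Leaf Leaf (corolla Succ)) dend1
    + lplug (StarR Prec Leaf lll) dend1 + lplug (StarR Prec Leaf lll) dend2
    + lplug (StarR Prec Leaf lll) dend3.
  by_terms.
by trivial_sum.
Qed.

(** Reducing all terms by [dend2] leaves x1 ≻ applied to [dend1] in x2, x3, x4. *)
Lemma ambiguity_Prec_Prec_Succ :
  trivial_mod S (graft (left_comb Prec Prec) 1 (corolla Succ))
    (lgraft dend1 1 (corolla Succ) - rgraft (corolla Prec) 1 dend2).
Proof.
have -> : lgraft dend1 1 (corolla Succ) - rgraft (corolla Prec) 1 dend2 =
    lplug (root3 Leaf (corolla Prec) Leaf) dend2
    - lplug (root3 Leaf Leaf (corolla Prec)) dend2
    - lplug (root3 Leaf Leaf (corolla Succ)) dend2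
    + lplug (StarR Succ Leaf lll) dend1.
  by_terms.
by trivial_sum.
Qed.

(** Reducing ((x1 ≺ x2) ≻ x3) ≺ x4 supplies the term that completes (x1 ∗ x2) ≻ (x3 ≺ x4), to which
    [dend3] applies. That tree lies below the ambiguity because its first word ≺≻≺ is smaller than
    ≺≻≻. *)
Lemma ambiguity_Prec_Succ_Succ :
  trivial_mod S (graft (left_comb Prec Succ) 1 (corolla Succ))
    (lgraft dend2 1 (corolla Succ) - rgraft (corolla Prec) 1 dend3).
Proof.
have -> : lgraft dend2 1 (corolla Succ) - rgraft (corolla Prec) 1 dend3 =
    lplug (root3 Leaf (corolla Succ) Leaf) dend2
    - lplug (root3 (corolla Prec) Leaf Leaf) dend2
    - lplug (root3 Leaf Leaf (corolla Prec)) dend3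
    + lplug (StarR Succ Leaf lll) dend2.
  by_terms.
by trivial_sum.
Qed.

(** The terms collect to (x1 ∗ (x2 ∗ x3)) ≻ x4 - (x1 ∗ x2) ≻ (x3 ≻ x4), and both reduce to x1 ≻ (x2
    ≻ (x3 ≻ x4)). [dend1] enters because reducing ((x1 ≺ x2) ≻ x3) ≻ x4 creates ((x1 ≺ x2) ≺ x3) ≻
    x4. *)
Lemma ambiguity_Succ_Succ_Succ :
  trivial_mod S (graft (left_comb Succ Succ) 1 (corolla Succ))
    (lgraft dend3 1 (corolla Succ) - rgraft (corolla Succ) 1 dend3).
Proof.
have -> : lgraft dend3 1 (corolla Succ) - rgraft (corolla Succ) 1 dend3 =
    lplug (StarL Succ lll Leaf) dend1 + lplug (StarL Succ lll Leaf) dend2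
    + lplug (StarR Succ Leaf lll) dend3
    + lplug (root3 Leaf (corolla Prec) Leaf) dend3
    + lplug (root3 Leaf (corolla Succ) Leaf) dend3
    - lplug (root3 (corolla Prec) Leaf Leaf) dend3
    - lplug (root3 Leaf Leaf (corolla Succ)) dend3.
  by_terms.
by trivial_sum.
Qed.

Lemma DSu_set_spec f : S f ->
  [/\ homogeneous (arity f) f, Defs.monic f & exists a b, lead f = left_comb a b].
Proof.
case/DSu_setP => ->; rewrite /arity ?lead_dend1 ?lead_dend2 ?lead_dend3.
- by split; [apply: homogeneous_terms | apply lead_terms | do 2!eexists].
- by split; [apply: homogeneous_terms | apply lead_terms | do 2!eexists].
- by split; [apply: homogeneous_terms | apply lead_terms | do 2!eexists].
Qed.

Lemma DSu_set_lead_inj f g : S f -> S g -> lead f = lead g -> f = g.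
Proof.
by move=> /DSu_setP[] -> /DSu_setP[] ->;
  rewrite ?lead_dend1 ?lead_dend2 ?lead_dend3.
Qed.

End Dendriform.

Theorem theorem3p2 (K : fieldType) :
  [/\ DSu 1 (R_As K) = prec (prec (triv K) (triv K)) (triv K)
                       - prec (triv K) (ast (triv K) (triv K)),
      DSu 2 (R_As K) = prec (succ (triv K) (triv K)) (triv K)
                       - succ (triv K) (prec (triv K) (triv K)),
      DSu 3 (R_As K) = succ (ast (triv K) (triv K)) (triv K)
                       - succ (triv K) (succ (triv K) (triv K))
    & groebner_shirshov (DSu_set 3 (R_As K))].
Proof.
(* The displayed relations agree with [DSu_R_As] by evaluating [dsu_tree] on the two concrete
   trees. *)
split; [exact: DSu_R_As | exact: DSu_R_As | exact: DSu_R_As | split].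
  by move=> f /DSu_set_spec[].
move=> f g w h Sf Sg; have [hom_g _ [a' [b' lead_g]]] := DSu_set_spec Sg.
have [_ _ [a [b lead_f]]] := DSu_set_spec Sf.
case=> [u v {}w i j|{}w q wf wg]; last first.
  (* Equal vertex counts make [q] act as the identity, so the leading trees coincide and the
     composition is [f - f]. *)
  have fg : f = g.
    apply: (DSu_set_lead_inj Sf Sg); rewrite -wf wg.
    apply: (plug_same_vertices (t := lead g)) => //.
    by rewrite -wg wf lead_f lead_g.
  rewrite lplug_same_vertices -?wg ?wf ?fg // subrr; exact: trivial_mod0.
rewrite lead_f lead_g => i3 jv wu wv w_gt2 w_lt4.
have [i1 j1 ub' va bb] := left_comb_overlap i3 jv wu wv w_gt2 w_lt4.
move: Sf Sg lead_f lead_g; rewrite {}wu {w wv w_gt2 w_lt4 i3 jv} i1 j1 ub' va.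
(* Of the nine pairs, four have the lower decoration of [lead f] equal to the root decoration of
   [lead g]. *)
move: bb => <-; case/DSu_setP=> ->; case/DSu_setP=> ->;
  rewrite ?lead_dend1 ?lead_dend2 ?lead_dend3 => -[<- <-] [] // <-.
- exact: ambiguity_Prec_Prec_Prec.
- exact: ambiguity_Prec_Prec_Succ.
- exact: ambiguity_Prec_Succ_Succ.
- exact: ambiguity_Succ_Succ_Succ.
Qed.
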